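(* Let $\mathbb{Z}^2$ be equipped with the connection $\mathcal{C}$ induced by a neighbor relation $r$ as in the context. Then the operators $L_n$, $U_n$, $n=1,2,\dots$, and their compositions are all total variation preserving.
   Context: $\mathcal{A}(\mathbb{Z}^2)$ is the space of all functions $f:\mathbb{Z}^2\to\mathbb{R}$; $id$ is the identity operator and $(id-P)(f)=f-P(f)$. Neighbor relation: $r$ is a relation on $\mathbb{Z}^2$ which is reflexive, symmetric and shift invariant, and satisfies $((i,j),(i\pm1,j))\in r$ and $((i,j),(i,j\pm1))\in r$ for all $i,j\in\mathbb{Z}$; $p,q$ are neighbors if $(p,q)\in r$. A set $C\subseteq\mathbb{Z}^2$ is connected if for any two $p,q\in C$ there is a set $\{p_1,\dots,p_k\}\subseteq C$ such that $p$ is a neighbor of $p_1$, each $p_i$ is a neighbor of $p_{i+1}$, and $p_k$ is a neighbor of $q$. $\mathcal{C}$ is the family of all connected sets. For $x\in\mathbb{Z}^2$ and an integer $n\ge 1$ let $\mathcal{N}_n(x)=\{V\in\mathcal{C}:x\in V,\ \mathrm{card}(V)=n+1\}$ and $$L_n(f)(x)=\max_{V\in\mathcal{N}_n(x)}\min_{y\in V}f(y),\qquad U_n(f)(x)=\min_{V\in\mathcal{N}_n(x)}\max_{y\in V}f(y).$$ Total variation: $TV(f)=\sum_{i=-\infty}^\infty\sum_{j=-\infty}^\infty\big(|f(i+1,j)-f(i,j)|+|f(i,j+1)-f(i,j)|\big)$, and $BV(\mathbb{Z}^2)$ is the set of all $f\in\mathcal{A}(\mathbb{Z}^2)$ with $TV(f)<\infty$.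 An operator $P:BV(\mathbb{Z}^2)\to BV(\mathbb{Z}^2)$ is total variation preserving if $TV(f)=TV(P(f))+TV((id-P)(f))$ for all $f\in BV(\mathbb{Z}^2)$. *)

(* Defs.v *)
From mathcomp Require Import all_boot all_order all_algebra.
From mathcomp Require Import finmap.
From mathcomp Require Import all_classical all_reals all_analysis.

Set Implicit Arguments.
Unset Strict Implicit.
Unset Printing Implicit Defensive.

Import Order.TTheory GRing.Theory Num.Theory.

Local Open Scope classical_set_scope.
Local Open Scope ring_scope.

Notation Z2 := (int * int)%type.

Record neighbor_relation (r : rel Z2) : Prop := NeighborRelation {
  nbr_refl : reflexive r;
  nbr_sym : symmetric r;
  nbr_shift : forall s p q : Z2, r p q -> r (p + s) (q + s);
  nbr_horizontal : forall i j : int,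
    r (i, j) (i + 1, j) /\ r (i, j) (i - 1, j);
  nbr_vertical : forall i j : int,
    r (i, j) (i, j + 1) /\ r (i, j) (i, j - 1)
}.

(* The intermediate points p_1, ..., p_k form the sequence s, with k >= 1. *)
Definition connected_in (r : rel Z2) (C : set Z2) : Prop :=
  forall p q : Z2, C p -> C q ->
  exists s : seq Z2,
    [/\ (0 < size s)%N, (forall x, x \in s -> C x) & path r p (rcons s q)].

Definition conn_nbhs (r : rel Z2) (n : nat) (x : Z2) : set {fset Z2} :=
  [set V | [/\ connected_in r [set` V], x \in V & #|` V| = n.+1]].

Section LULU.
Context {R : realType}.
Implicit Types (f : Z2 -> R) (V : {fset Z2}) (x : Z2).

(* Only used when x \in V, so that the default value f x is neutral and these
   are the minimum and the maximum of f over the finite set V. *)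
Definition fmin f x V : R := \big[Num.min/f x]_(y <- V) f y.
Definition fmax f x V : R := \big[Num.max/f x]_(y <- V) f y.

(* The outer extremum is a sup (resp. inf) because conn_nbhs r n x may be
   infinite when points have infinitely many neighbors.  The set of values is
   nonempty and bounded above (resp. below) by f x, and by Lop_max and Uop_min
   this is the max (resp. min) whenever the latter is attained. *)
Definition Lop (r : rel Z2) (n : nat) f : Z2 -> R :=
  fun x => sup [set fmin f x V | V in conn_nbhs r n x].
Definition Uop (r : rel Z2) (n : nat) f : Z2 -> R :=
  fun x => inf [set fmax f x V | V in conn_nbhs r n x].

Lemma Lop_max (r : rel Z2) (n : nat) f x V0 : conn_nbhs r n x V0 ->
  (forall V, conn_nbhs r n x V -> fmin f x V <= fmin f x V0) ->
  Lop r n f x = fmin f x V0.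
Proof.
move=> NV0 V0max; apply/eqP; rewrite eq_le; apply/andP; split.
  by apply: ge_sup => [|_ [V NV <-]]; [exists (fmin f x V0), V0 | exact: V0max].
apply: ub_le_sup; last by exists V0.
by exists (fmin f x V0) => _ [V NV <-]; exact: V0max.
Qed.

Lemma Uop_min (r : rel Z2) (n : nat) f x V0 : conn_nbhs r n x V0 ->
  (forall V, conn_nbhs r n x V -> fmax f x V0 <= fmax f x V) ->
  Uop r n f x = fmax f x V0.
Proof.
move=> NV0 V0min; apply/eqP; rewrite eq_le; apply/andP; split; last first.
  by apply: lb_le_inf => [|_ [V NV <-]]; [exists (fmax f x V0), V0 | exact: V0min].
apply: ge_inf; last by exists V0.
by exists (fmax f x V0) => _ [V NV <-]; exact: V0min.
Qed.

Definition TV f : \bar R :=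
  (\esum_(i in [set: int]) \esum_(j in [set: int])
    (`|f (i + 1, j) - f (i, j)| + `|f (i, j + 1) - f (i, j)|)%R%:E)%E.

Definition BV : set (Z2 -> R) := [set f | (TV f < +oo)%E].

(* The first component says that P restricts to an operator BV -> BV. *)
Definition tv_preserving (P : (Z2 -> R) -> (Z2 -> R)) : Prop :=
  (forall f, BV f -> BV (P f)) /\
  (forall f, BV f -> TV f = (TV (P f) + TV (f \- P f)%R)%E).

(* The finite compositions, in any order, of the operators L_n and U_n with
   n >= 1, including the operators themselves. *)
Inductive LU_composition (r : rel Z2) : ((Z2 -> R) -> (Z2 -> R)) -> Prop :=
| LU_L (n : nat) : (1 <= n)%N -> LU_composition r (Lop r n)
| LU_U (n : nat) : (1 <= n)%N -> LU_composition r (Uop r n)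
| LU_comp P Q : LU_composition r P -> LU_composition r Q ->
    LU_composition r (P \o Q).

End LULU.

(* Main.v *)
(** For neighbours p, q the operator L = L_n satisfies L f <= f and
    min (L f p) (f q) <= L f q: a connected set V containing p stays connected
    when q is added, and V ∪ {q} contains a connected set of the original size
    containing q.  Hence f p <= f q forces 0 <= L f q - L f p <= f q - f p, so
    that |f q - f p| splits exactly between L f and f - L f along every edge.
    The operators U_n follow from U_n f = - L_n (- f), and compositions from the
    subadditivity of the total variation. *)
Require Import Defs.
From mathcomp Require Import all_boot all_order all_algebra.
From mathcomp Require Import finmap.
From mathcomp Require Import all_classical all_reals all_analysis.
From mathcomp Require Import lra.

Set Implicit Arguments.
Unset Strict Implicit.
Unset Printing Implicit Defensive.

Import Order.TTheory GRing.Theory Num.Theory.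

Local Open Scope classical_set_scope.
Local Open Scope ring_scope.

(** Chains need at least one intermediate point; by reflexivity [x] itself serves. *)
Lemma connected_in_set1 (r : rel Z2) (x : Z2) :
  reflexive r -> connected_in r [set x].
Proof.
move=> rr p q -> ->; exists [:: x]; split => //=; last by rewrite !rr.
by move=> y; rewrite inE => /eqP.
Qed.

(** Any chain entering or leaving [b] is routed through [a]. *)
Lemma connected_in_setU1 (r : rel Z2) (C : set Z2) (a b : Z2) :
  neighbor_relation r -> connected_in r C -> C a -> r a b ->
  connected_in r (b |` C).
Proof.
move=> hr Ccon Ca rab.
have rba : r b a by rewrite (nbr_sym hr).
move=> p q [->|Cp] [->|Cq].
- exists [:: b]; split => //=; last by rewrite !(nbr_refl hr).
  by move=> y; rewrite inE => /eqP ->; left.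
- have [s [s0 sC sp]] := Ccon _ _ Ca Cq.
  exists (a :: s); split => //=; last by rewrite rba.
  by move=> y; rewrite inE => /orP[/eqP ->|/sC]; right.
- have [s [s0 sC sp]] := Ccon _ _ Cp Ca.
  exists (rcons s a); split; first by rewrite size_rcons.
    by move=> y; rewrite mem_rcons inE => /orP[/eqP ->|/sC]; right.
  by rewrite rcons_path sp last_rcons.
- have [s [s0 sC sp]] := Ccon _ _ Cp Cq.
  by exists s; split => // y /sC; right.
Qed.

Lemma path_exit (T : eqType) (e : rel T) (A : pred T) (x : T) (s : seq T) :
  path e x s -> A x -> ~~ A (last x s) ->
  exists a b, [/\ A a, ~~ A b, e a b & b \in s].
Proof.
elim: s x => [|y s IH] x /=; first by move=> _ ->.
move=> /andP[exy ys] Ax Al; have [Ay|nAy] := boolP (A y).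
  have [a [b [Aa Ab eab bs]]] := IH y ys Ay Al.
  by exists a, b; split => //; rewrite inE bs orbT.
by exists x, y; split => //; rewrite inE eqxx.
Qed.

Lemma connected_in_fsetU1 (r : rel Z2) (V : {fset Z2}) (a b : Z2) :
  neighbor_relation r -> connected_in r [set` V] -> a \in V -> r a b ->
  connected_in r [set` (b |` V)%fset].
Proof. by rewrite set_fsetU1; exact: connected_in_setU1. Qed.

(** Grow from [q] one point at a time: while the set built so far misses some [w] of [W], a chain
    inside [W] from [q] to [w] must leave it, and the first point outside is adjacent to it and can
    be added. *)
Lemma connected_subset_card (r : rel Z2) (W : {fset Z2}) (q : Z2) (k : nat) :
  neighbor_relation r -> connected_in r [set` W] -> q \in W ->
  (k < #|` W|)%N -> exists2 V, conn_nbhs r k q V & (V `<=` W)%fset.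
Proof.
move=> hr Wcon qW; elim: k => [_|k IH kW].
  exists [fset q]%fset; last by rewrite fsub1set.
  split; rewrite ?cardfs1 ?inE //.
  by rewrite set_fset1; apply: connected_in_set1; exact: nbr_refl hr.
have [V [Vcon qV Vk] VW] := IH (ltnW kW).
have /fsubsetPn[w wW wV] : ~~ (W `<=` V)%fset.
  by apply/negP => /fsubset_leq_card; rewrite Vk leqNgt kW.
have [s [_ sW sp]] := Wcon q w qW wW.
have [|a [b [aV bV rab]]] := path_exit (A := mem V) sp qV.
  by rewrite last_rcons.
rewrite mem_rcons inE => bs.
have bW : b \in W by case/predU1P: bs => [->//|/sW].
exists (b |` V)%fset; last by rewrite fsubUset fsub1set bW.
split; first exact: connected_in_fsetU1 rab.
- by rewrite !inE qV orbT.
- by rewrite cardfsU1 bV Vk.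
Qed.

(** Ensures that the supremum in [Lop] is not taken over the empty set. The witness is a horizontal
    segment starting at [x]; the induction also records its right end and that no point lies further
    right, so that the next point is new. *)
Lemma conn_nbhs_neq0 (r : rel Z2) (n : nat) (x : Z2) :
  neighbor_relation r -> conn_nbhs r n x !=set0.
Proof.
move=> hr.
suff [V [NV _ _]] : exists V, [/\ conn_nbhs r n x V,
    (x.1 + n%:Z, x.2) \in V & forall y, y \in V -> y.1 <= x.1 + n%:Z].
  by exists V.
elim: n => [|n [V [[Vcon xV Vn] lV leV]]].
  exists [fset x]%fset; rewrite addr0; split; rewrite ?inE -?surjective_pairing //.
    split; rewrite ?cardfs1 ?inE //.
    by rewrite set_fset1; apply: connected_in_set1; exact: nbr_refl hr.
  by move=> y; rewrite inE => /eqP ->.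
pose b : Z2 := (x.1 + n.+1%:Z, x.2).
have bE : b = (x.1 + n%:Z + 1, x.2) by rewrite /b intS (addrC 1) addrA.
have bV : b \notin V.
  by apply/negP => /leV; rewrite bE /=; lra.
exists (b |` V)%fset; split; last first.
- move=> y; rewrite !inE => /orP[/eqP -> //|/leV yn].
  by rewrite intS; lra.
- by rewrite !inE eqxx.
split.
- apply: connected_in_fsetU1 lV _ => //.
  by rewrite bE; have [] := nbr_horizontal hr (x.1 + n%:Z) x.2.
- by rewrite !inE xV orbT.
- by rewrite cardfsU1 bV Vn.
Qed.

Lemma conn_nbhs_move (r : rel Z2) (n : nat) (p q : Z2) (V : {fset Z2}) :
  neighbor_relation r -> r p q -> conn_nbhs r n p V ->
  exists2 W, conn_nbhs r n q W & (W `<=` q |` V)%fset.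
Proof.
move=> hr rpq [Vcon pV Vn]; apply: connected_subset_card => //.
- exact: connected_in_fsetU1 rpq.
- by rewrite !inE eqxx.
(* [q] may already lie in [V]; either way the union has more than [n] points. *)
- by rewrite cardfsU1 Vn ltn_addl.
Qed.

Section Operators.
Context {R : realType}.
Implicit Types (f g : Z2 -> R) (V : {fset Z2}) (p q x : Z2) (r : rel Z2).

Lemma le_fminP f x V (c : R) : x \in V ->
  reflect (forall y, y \in V -> c <= f y) (c <= fmin f x V).
Proof.
move=> xV; apply: (iffP idP) => [cV y yV|cV].
  by apply: le_trans cV _; exact: ge_bigmin_seq yV isT.
rewrite /fmin big_seq; apply: le_bigmin => [|y]; [exact: cV | exact: cV].
Qed.

Lemma fmin_le f x V y : x \in V -> y \in V -> fmin f x V <= f y.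
Proof. by move=> xV; have /(le_fminP _ _ xV) := lexx (fmin f x V); exact. Qed.

Lemma Lop_ub r n f x : has_ubound [set fmin f x V | V in conn_nbhs r n x].
Proof. by exists (f x) => _ [V [_ xV _] <-]; exact: fmin_le. Qed.

Lemma Lop_le r n f x : neighbor_relation r -> Lop r n f x <= f x.
Proof.
move=> hr; have [V NV] := conn_nbhs_neq0 n x hr.
apply: ge_sup => [|_ [W [_ xW _] <-]]; last exact: fmin_le.
by exists (fmin f x V), V.
Qed.

Lemma Lop_nbr r n f p q : neighbor_relation r -> r p q ->
  Num.min (Lop r n f p) (f q) <= Lop r n f q.
Proof.
move=> hr rpq; rewrite leNgt; apply/negP; rewrite lt_min => /andP[Lqp Lqf].
(* The supremum at [p] need not be attained, but some [V] has a minimum already exceeding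
   [Lop r n f q]; moving it to [q] gives the contradiction. *)
have [|_ [V NV <-] LqV] := sup_gt _ Lqp.
  by have [V NV] := conn_nbhs_neq0 n p hr; exists (fmin f p V), V.
have [W NW WV] := conn_nbhs_move hr rpq NV.
have LW : fmin f q W <= Lop r n f q.
  by apply: ub_le_sup; [exact: Lop_ub | exists W].
have [_ pV _] := NV; have [_ qW _] := NW.
suff : Num.min (fmin f p V) (f q) <= fmin f q W.
  by move=> /le_trans/(_ LW); rewrite leNgt lt_min LqV Lqf.
apply/le_fminP => // y /(fsubsetP WV); rewrite !inE ge_min.
by move=> /predU1P[->|yV]; rewrite ?lexx ?orbT // fmin_le.
Qed.

Lemma Lop_edge r n f p q : neighbor_relation r -> r p q ->
  `|f q - f p| =
  `|Lop r n f q - Lop r n f p| + `|(f q - Lop r n f q) - (f p - Lop r n f p)|.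
Proof.
move=> hr; wlog fpq : p q / f p <= f q => [hw rpq|rpq].
  have [/hw -> //|/ltW/hw] := leP (f p) (f q).
  rewrite (nbr_sym hr) => /(_ rpq).
  by rewrite distrC (distrC (Lop r n f p)) (distrC (f p - _)).
have rqp : r q p by rewrite (nbr_sym hr).
have Lp := Lop_le n f p hr.
(* From [p] to [q] the minimum in [Lop_nbr] is [Lop r n f p], which is at most [f p], hence at most
   [f q]. *)
have Lpq : Lop r n f p <= Lop r n f q.
  by have := Lop_nbr n f hr rpq; rewrite min_l // (le_trans Lp).
have Lqp : Lop r n f q - Lop r n f p <= f q - f p.
  (* From [q] to [p]: either [Lop r n f q] is at most [Lop r n f p], and the left side is
     nonpositive, or [f p] is at most [Lop r n f p], and [Lop_le] at [q] concludes. *)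
  have := Lop_nbr n f hr rqp; have := Lop_le n f q hr.
  by rewrite ge_min => Lq /orP[|]; lra.
by rewrite !ger0_norm; lra.
Qed.

Lemma UopE r n f x : Uop r n f x = - Lop r n (\- f) x.
Proof.
rewrite /Uop /Lop /inf; congr (- sup _).
rewrite image_comp; apply: eq_imagel => V _ /=.
by rewrite /fmax /fmin (big_morph -%R (@oppr_max R) erefl).
Qed.

Lemma Uop_edge r n f p q : neighbor_relation r -> r p q ->
  `|f q - f p| =
  `|Uop r n f q - Uop r n f p| + `|(f q - Uop r n f q) - (f p - Uop r n f p)|.
Proof.
move=> hr rpq; rewrite !UopE -normrN.
have -> : - (f q - f p) = (\- f) q - (\- f) p by rewrite /=; lra.
rewrite (Lop_edge n (\- f) hr rpq) /=.
by congr (_ + _); rewrite -normrN; congr Num.norm; lra.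
Qed.

Definition edge_variation f (i j : int) : R :=
  `|f (i + 1, j) - f (i, j)| + `|f (i, j + 1) - f (i, j)|.

Lemma edge_variation_ge0 f i j : 0 <= edge_variation f i j.
Proof. exact: addr_ge0. Qed.

Lemma TV_ge0 f : (0 <= TV f)%E.
Proof.
apply: esum_ge0 => i _; apply: esum_ge0 => j _.
by rewrite lee_fin edge_variation_ge0.
Qed.

Lemma esum_edge_variationD f g :
  (TV f + TV g = \esum_(i in [set: int]) \esum_(j in [set: int])
    (edge_variation f i j + edge_variation g i j)%:E)%E.
Proof.
rewrite /TV -esumD; last 2 first.
- move=> i _; apply: esum_ge0 => j _; rewrite lee_fin; exact: edge_variation_ge0.
- move=> i _; apply: esum_ge0 => j _; rewrite lee_fin; exact: edge_variation_ge0.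
apply: eq_esum => i _; rewrite -esumD.
- by apply: eq_esum => j _; rewrite EFinD.
- by move=> j _; rewrite lee_fin; exact: edge_variation_ge0.
- by move=> j _; rewrite lee_fin; exact: edge_variation_ge0.
Qed.

Lemma TV_le_add f g : (TV (f \+ g)%R <= TV f + TV g)%E.
Proof.
rewrite esum_edge_variationD; apply: le_esum => i _; apply: le_esum => j _.
rewrite lee_fin /edge_variation /= addrACA.
by apply: lerD; rewrite opprD addrACA ler_normD.
Qed.

Lemma edge_tv_preserving r (P : (Z2 -> R) -> (Z2 -> R)) :
  neighbor_relation r ->
  (forall f p q, r p q -> `|f q - f p| =
    `|P f q - P f p| + `|(f q - P f q) - (f p - P f p)|) ->
  tv_preserving P.
Proof.
move=> hr Pedge.
(* Holds in the extended reals for every [f], so it also yields stability of [BV]. *)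
have TVP f : (TV f = TV (P f) + TV (f \- P f)%R)%E.
  rewrite esum_edge_variationD; apply: eq_esum => i _; apply: eq_esum => j _.
  have [rh _] := nbr_horizontal hr i j; have [rv _] := nbr_vertical hr i j.
  by rewrite (Pedge f _ _ rh) (Pedge f _ _ rv) addrACA.
split=> // f; rewrite /BV /= TVP; apply: le_lt_trans.
by rewrite leeDl // TV_ge0.
Qed.

Lemma tv_preserving_comp (P Q : (Z2 -> R) -> (Z2 -> R)) :
  tv_preserving P -> tv_preserving Q -> tv_preserving (P \o Q).
Proof.
move=> [PBV PTV] [QBV QTV]; split=> [f /QBV/PBV //|f fBV].
have split_le (g h : Z2 -> R) : (TV g <= TV h + TV (g \- h)%R)%E.
  have {1}-> : g = h \+ (g \- h) by apply/funext => x /=; rewrite addrC subrK.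
  exact: TV_le_add.
(* Subadditivity gives one inequality. For the other, expand [TV f] through [Q] and then [P]; the
   two remainders [Q f - P (Q f)] and [f - Q f] telescope to [f - P (Q f)]. *)
apply/eqP; rewrite eq_le split_le /= (QTV f fBV) (PTV (Q f) (QBV f fBV)) -addeA.
rewrite leeD2l //.
have -> : f \- P (Q f) = (Q f \- P (Q f)) \+ (f \- Q f).
  by apply/funext => x /=; lra.
exact: TV_le_add.
Qed.

End Operators.

Theorem theorem19 (R : realType) (r : rel Z2) (hr : neighbor_relation r)
    (P : (Z2 -> R) -> (Z2 -> R)) :
  LU_composition r P -> tv_preserving P.
Proof.
elim=> [n _|n _|{}P Q _ tvP _ tvQ].
- by apply: (edge_tv_preserving hr) => f p q; exact: Lop_edge.
- by apply: (edge_tv_preserving hr) => f p q; exact: Uop_edge.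
- exact: tv_preserving_comp.
Qed.
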